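(* Let $A=A_s+\epsilon A_i$ be a dual real matrix with $A_s,A_i\in\mathbb{R}^{m\times n}$, $m\ge n$. Assume that $A_s=L_sU_s$ is the LU decomposition of $A_s$, where $k\le\min\{m,n\}$, $L_s\in\mathbb{R}^{m\times k}$ is a lower trapezoidal matrix with rank $k$, and $U_s\in\mathbb{R}^{k\times n}$ is an upper trapezoidal matrix with rank $k$. Then the LU decomposition $A=LU$ of the dual matrix, where $L=L_s+\epsilon L_i$ is an $m\times k$ lower trapezoidal dual real matrix and $U=U_s+\epsilon U_i$ is a $k\times n$ upper trapezoidal dual real matrix (with the given standard parts $L_s$, $U_s$), exists if and only if $$(I_m-L_sL_s^\dagger)A_i(I_n-U_s^\dagger U_s)=O_{m\times n}.$$ Additionally, the expressions of the infinitesimal parts $L_i$, $U_i$ of $L$, $U$ are $$L_i=(I_m-L_sL_s^\dagger)A_iU_s^\dagger+L_sP,\qquad U_i=L_s^\dagger A_i-PU_s,$$ where $P\in\mathbb{R}^{k\times k}$. With $B=L_s^\dagger A_i\in\mathbb{R}^{k\times n}$ and $C=(I_m-L_sL_s^\dagger)A_iU_s^\dagger\in\mathbb{R}^{m\times k}$, the (strictly) lower triangular part of $P$ is given recursively, for $t=1,2,\dots,k-1$, by $$P(t+1:k,\,t)=\frac{1}{U_s(t,t)}\bigl(B(t+1:k,\,t)-P(t+1:k,\,1:t-1)\,U_s(1:t-1,\,t)\bigr),$$ and the (strictly) upper triangular part of $P$ is given recursively, for $t=1,2,\dots,k-1$, by $$P(t,\,t+1:k)=\frac{1}{L_s(t,t)}\bigl(-C(t,\,t+1:k)-L_s(t,\,1:t-1)\,P(1:t-1,\,t+1:k)\bigr),$$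 where for $t=1$ the product terms are absent.
   Context: A dual real matrix is a formal expression $A=A_s+\epsilon A_i$ with real matrices $A_s$ (standard part) and $A_i$ (infinitesimal part), where $\epsilon^2=0$ and $\epsilon$ commutes with everything; thus $(L_s+\epsilon L_i)(U_s+\epsilon U_i)=L_sU_s+\epsilon(L_sU_i+L_iU_s)$. A matrix $M$ is lower (upper) trapezoidal if $M(i,j)=0$ whenever $j>i$ (respectively $i>j$); a dual matrix is lower (upper) trapezoidal if both its standard and infinitesimal parts are. $M^\dagger$ is the Moore-Penrose pseudoinverse of a real matrix $M$. $I_m$ is the $m\times m$ identity matrix and $O_{m\times n}$ the $m\times n$ zero matrix. MATLAB notation is used: $M(a:b,c:d)$ is the submatrix of $M$ with rows $a,\dots,b$ and columns $c,\dots,d$; $M(a:b,c)$ and $M(a,c:d)$ are the corresponding column and row segments.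
   Formalization: It is additionally assumed that L_s(t,t) and U_s(t,t) are nonzero for t=1,…,k-1; the recursions divide by them, rank k does not imply it, and the ''if'' fails otherwise (L_s with rows (0 0),(1 0),(0 1), U_s=I_2, A_i(1,2)≠0). *)

(* Defs.v *)
(* Real matrices are MathComp matrices over an arbitrary R : realType. *)
From HB Require Import structures.
From mathcomp Require Import all_boot all_order all_algebra.
From mathcomp Require Import reals.

Set Implicit Arguments.
Unset Strict Implicit.
Unset Printing Implicit Defensive.

Import Order.TTheory GRing.Theory Num.Theory.
Local Open Scope ring_scope.

Section MoorePenrose.
Variables (R : realType) (m n : nat).

(* Over the reals the conjugate transpose of the Penrose equations is ^T. *)
Definition penrose (M : 'M[R]_(m, n)) : pred 'M[R]_(n, m) := fun X =>
  [&& M *m X *m M == M, X *m M *m X == X,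
      (M *m X)^T == M *m X & (X *m M)^T == X *m M].

Lemma gram_unit p q (F : 'M[R]_(p, q)) : row_free F -> F *m F^T \in unitmx.
Proof.
move=> Ffree; rewrite -row_free_unit; apply: inj_row_free => v vFF.
suff vF0 : v *m F = 0 by apply/eqP; rewrite -(mulmx_free_eq0 v Ffree) vF0.
have : (v *m F) *m (v *m F)^T = 0.
  by rewrite trmx_mul mulmxA -(mulmxA v) vFF mul0mx.
move: (v *m F) => w /matrixP/(_ 0 0); rewrite !mxE => /eqP.
rewrite psumr_eq0 => [/allP w0|j _]; last by rewrite mxE -expr2 sqr_ge0.
apply/rowP => j; have := w0 j (mem_index_enum j).
by rewrite !mxE -expr2 sqrf_eq0 => /eqP.
Qed.

Lemma penrose_exists (M : 'M[R]_(m, n)) : exists X, penrose M X.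
Proof.
have [r [C [F [DM Cfree Ffree]]]] : exists r, exists C : 'M[R]_(m, r),
    exists F : 'M[R]_(r, n), [/\ M = C *m F, row_free C^T & row_free F].
  exists (\rank M), (col_base M), (row_base M); split; first by rewrite mulmx_base.
    by rewrite /row_free mxrank_tr; exact: col_base_full.
  exact: row_base_free.
have UF := gram_unit Ffree; have := gram_unit Cfree; rewrite trmxK => UC.
set GF := F *m F^T in UF; set GC := C^T *m C in UC.
have GFT : GF^T = GF by rewrite /GF trmx_mul trmxK.
have GCT : GC^T = GC by rewrite /GC trmx_mul trmxK.
pose X := F^T *m invmx GF *m invmx GC *m C^T.
have MX : M *m X = C *m invmx GC *m C^T.
  by rewrite DM /X !mulmxA -(mulmxA C F) -/GF -(mulmxA C GF) mulmxV // mulmx1.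
have XM : X *m M = F^T *m invmx GF *m F.
  by rewrite DM /X !mulmxA -(mulmxA _ C^T C) -/GC mulmxKV.
exists X; apply/and4P; split; apply/eqP.
- by rewrite MX {1}DM !mulmxA -(mulmxA _ C^T C) -/GC mulmxKV // -DM.
- by rewrite XM /X !mulmxA -(mulmxA _ F F^T) -/GF mulmxKV.
- by rewrite MX !trmx_mul trmxK trmx_inv GCT mulmxA.
- by rewrite XM !trmx_mul trmxK trmx_inv GFT mulmxA.
Qed.

Lemma penrose_unique (M : 'M[R]_(m, n)) X Y :
  penrose M X -> penrose M Y -> X = Y.
Proof.
case/and4P=> /eqP X1 /eqP X2 /eqP X3 /eqP X4.
case/and4P=> /eqP Y1 /eqP Y2 /eqP Y3 /eqP Y4.
have MXY : M *m X = M *m Y.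
  rewrite -{1}Y1 -(mulmxA _ M X) -[M *m Y]Y3 -[M *m X]X3 -trmx_mul.
  by rewrite mulmxA X1.
have XMY : X *m M = Y *m M.
  rewrite -{1}Y1 -(mulmxA M) mulmxA -[Y *m M]Y4 -[X *m M]X4 -trmx_mul.
  by rewrite -(mulmxA Y M) (mulmxA M) X1.
by rewrite -X2 XMY -mulmxA MXY mulmxA Y2.
Qed.

Definition mpinv (M : 'M[R]_(m, n)) : 'M[R]_(n, m) :=
  xchoose (penrose_exists M).

Lemma mpinvP (M : 'M[R]_(m, n)) : penrose M (mpinv M).
Proof. exact: xchooseP. Qed.

End MoorePenrose.

Section Trapezoidal.
Variables (R : realType) (m n : nat).

(* [is_trig_mx M] says M i j = 0 whenever i < j, for rectangular M. *)
Definition lower_trapezoidal (M : 'M[R]_(m, n)) : bool := is_trig_mx M.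
Definition upper_trapezoidal (M : 'M[R]_(m, n)) : bool := is_trig_mx M^T.

End Trapezoidal.

(* The dual matrix A_s + eps A_i. *)
Record dualmx (R : realType) (m n : nat) := DualMx {
  std_part : 'M[R]_(m, n);
  inf_part : 'M[R]_(m, n)
}.

Section DualMatrices.
Variable R : realType.

Definition dual_mulmx m k n (L : dualmx R m k) (U : dualmx R k n) :
    dualmx R m n :=
  DualMx (std_part L *m std_part U)
         (std_part L *m inf_part U + inf_part L *m std_part U).

Definition dual_lower_trapezoidal m n (A : dualmx R m n) : bool :=
  lower_trapezoidal (std_part A) && lower_trapezoidal (inf_part A).

Definition dual_upper_trapezoidal m n (A : dualmx R m n) : bool :=
  upper_trapezoidal (std_part A) && upper_trapezoidal (inf_part A).

Definition is_LU m k n (A : 'M[R]_(m, n)) (L : 'M[R]_(m, k))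
    (U : 'M[R]_(k, n)) : Prop :=
  [/\ A = L *m U,
      lower_trapezoidal L /\ \rank L = k &
      upper_trapezoidal U /\ \rank U = k].

Definition is_dual_LU m k n (A : dualmx R m n) (L : dualmx R m k)
    (U : dualmx R k n) : Prop :=
  [/\ A = dual_mulmx L U, dual_lower_trapezoidal L &
      dual_upper_trapezoidal U].

End DualMatrices.

Section Recursions.
Variables (R : realType) (m n k : nat).
Hypothesis hk : (k <= minn m n)%N.

(* The index t < k seen as a row index of L_s and a column index of U_s. *)
Definition row_idx (t : 'I_k) : 'I_m :=
  widen_ord (leq_trans hk (geq_minl m n)) t.
Definition col_idx (t : 'I_k) : 'I_n :=
  widen_ord (leq_trans hk (geq_minr m n)) t.

(* The two segment recursions are written entrywise: s ranges over the segment
   t+1:k, and the product over 1:t-1 is the sum over r < t (empty for the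
   first t).  The last t contributes nothing, as no s lies above it. *)
Definition lower_recursion (Us : 'M[R]_(k, n)) (B : 'M[R]_(k, n))
    (P : 'M[R]_k) : Prop :=
  forall t s : 'I_k, (t < s)%N ->
    P s t = (Us t (col_idx t))^-1 *
      (B s (col_idx t) - \sum_(r < k | (r < t)%N) P s r * Us r (col_idx t)).

Definition upper_recursion (Ls : 'M[R]_(m, k)) (C : 'M[R]_(m, k))
    (P : 'M[R]_k) : Prop :=
  forall t s : 'I_k, (t < s)%N ->
    P t s = (Ls (row_idx t) t)^-1 *
      (- C (row_idx t) s - \sum_(r < k | (r < t)%N) Ls (row_idx t) r * P r s).

(* L_s(t,t) and U_s(t,t) are nonzero for the t = 1, ..., k-1 by which the
   recursions divide.  Rank k does not imply this: L_s may be the 3 x 2 matrix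
   with rows (0 0), (1 0), (0 1). *)
Definition nonzero_pivots (Ls : 'M[R]_(m, k)) (Us : 'M[R]_(k, n)) : Prop :=
  forall t : 'I_k, (t.+1 < k)%N ->
    Ls (row_idx t) t != 0 /\ Us t (col_idx t) != 0.

End Recursions.

(* Main.v *)
(* Since L_s^+ L_s = 1 and U_s U_s^+ = 1, the equation A_i = L_s U_i + L_i U_s
   forces the compatibility condition, and under that condition its solutions
   are parametrized by P = L_s^+ L_i.  Entry (t, s), t < s, of
   C + L_s P = L_i vanishes iff P(t, s) is the value prescribed by forward
   substitution; transposing gives the same for U_i = B - P U_s.  The
   recursion from L_i involves only strictly upper entries of P and the one from
   U_i only strictly lower ones, so they can be solved independently. *)
Require Import Defs.
From mathcomp Require Import all_boot all_order all_algebra.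
From mathcomp Require Import reals.
Import GRing.Theory.
Local Open Scope ring_scope.

(** Full column rank allows [L] to be cancelled on the left of the Penrose equation L L^+ L = L. *)
Lemma mpinv_mulV (R : realType) m k (L : 'M[R]_(m, k)) :
  \rank L = k -> mpinv L *m L = 1%:M.
Proof.
move=> rL; have /and4P[/eqP LXL _ _ _] := mpinvP L.
by apply: (row_full_inj (introT eqP rL)); rewrite mulmx1 mulmxA.
Qed.

Lemma mulmx_mpinv (R : realType) k n (U : 'M[R]_(k, n)) :
  \rank U = k -> U *m mpinv U = 1%:M.
Proof.
move=> rU; have /and4P[/eqP UXU _ _ _] := mpinvP U.
by apply: (row_free_inj (introT eqP rU)); rewrite mul1mx.
Qed.

Lemma coproj_mulmx (R : realType) m k (L : 'M[R]_(m, k)) :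
  (1%:M - L *m mpinv L) *m L = 0.
Proof.
have /and4P[/eqP LXL _ _ _] := mpinvP L.
by rewrite mulmxBl mul1mx LXL subrr.
Qed.

Lemma mulmx_coproj (R : realType) k n (U : 'M[R]_(k, n)) :
  U *m (1%:M - mpinv U *m U) = 0.
Proof.
have /and4P[/eqP UXU _ _ _] := mpinvP U.
by rewrite mulmxBr mulmx1 mulmxA UXU subrr.
Qed.

(** The left factor annihilates [L *m Ui] and the right factor annihilates [Li *m U]. *)
Lemma dual_factor_cond (R : realType) m n k (A : 'M[R]_(m, n))
    (L Li : 'M[R]_(m, k)) (U Ui : 'M[R]_(k, n)) :
  A = L *m Ui + Li *m U ->
  (1%:M - L *m mpinv L) *m A *m (1%:M - mpinv U *m U) = 0.
Proof.
move=> ->; rewrite (mulmxDr _ (L *m Ui)) mulmxA coproj_mulmx mul0mx add0r -!mulmxA.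
by rewrite mulmx_coproj !mulmx0.
Qed.

Lemma dual_factorP (R : realType) m n k (A : 'M[R]_(m, n))
    (L Li : 'M[R]_(m, k)) (U Ui : 'M[R]_(k, n)) :
  \rank L = k -> \rank U = k ->
  (1%:M - L *m mpinv L) *m A *m (1%:M - mpinv U *m U) = 0 ->
  A = L *m Ui + Li *m U <->
  exists P : 'M_k, Li = (1%:M - L *m mpinv L) *m A *m mpinv U + L *m P /\
                   Ui = mpinv L *m A - P *m U.
Proof.
move=> rL rU cond; split=> [DA | [P [-> ->]]].
  exists (mpinv L *m Li); split; rewrite DA mulmxDr !mulmxA.
    rewrite coproj_mulmx mul0mx add0r -(mulmxA _ U) (mulmx_mpinv _ _ _ _ rU) mulmx1.
    by rewrite mulmxBl mul1mx subrK.
  by rewrite (mpinv_mulV _ _ _ _ rL) mul1mx addrK.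
(* The condition now reads (1 - L L^+) A = (1 - L L^+) A U^+ U, so the two products add up to L L^+
   A + (1 - L L^+) A, the terms in [P] cancelling. *)
move: cond; rewrite mulmxBr mulmx1 mulmxA => /subr0_eq cond.
rewrite (mulmxDl _ (L *m P)) -cond mulmxBl mul1mx mulmxBr !mulmxA.
by rewrite addrC addrACA subrK subrr addr0.
Qed.

Lemma lower_trapezoidal_addmul (R : realType) m k (hkm : (k <= m)%N)
    (L C : 'M[R]_(m, k)) (P : 'M[R]_k) :
  lower_trapezoidal L ->
  (forall t : 'I_k, (t.+1 < k)%N -> L (widen_ord hkm t) t != 0) ->
  lower_trapezoidal (C + L *m P) <->
  forall t s : 'I_k, (t < s)%N ->
    P t s = (L (widen_ord hkm t) t)^-1 *
      (- C (widen_ord hkm t) s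
       - \sum_(r < k | (r < t)%N) L (widen_ord hkm t) r * P r s).
Proof.
move=> /is_trig_mxP trigL piv.
have entryE (t s : 'I_k) : (C + L *m P) (widen_ord hkm t) s =
    C (widen_ord hkm t) s + (L (widen_ord hkm t) t * P t s +
      \sum_(r < k | (r < t)%N) L (widen_ord hkm t) r * P r s).
  rewrite !mxE (bigID (fun r : 'I_k => (r < t)%N)) /=.
  congr (_ + _); rewrite addrC; congr (_ + _).
  (* Of the terms with r >= t only r = t survives, since [L] vanishes above its diagonal. *)
  rewrite (bigD1 t) ?ltnn //= big1 ?addr0 // => r /andP[ler nrt].
  rewrite trigL ?mul0r //= ltn_neqAle leqNgt ler andbT.
  by rewrite eq_sym.
have zeroE (t s : 'I_k) : (t < s)%N ->
    (C + L *m P) (widen_ord hkm t) s = 0 <->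
    P t s = (L (widen_ord hkm t) t)^-1 *
      (- C (widen_ord hkm t) s
       - \sum_(r < k | (r < t)%N) L (widen_ord hkm t) r * P r s).
  (* From t < s < k follows t + 1 < k, the range where the pivot is known to be nonzero. *)
  move=> lts; have Lt := piv t (leq_ltn_trans lts (ltn_ord s)).
  rewrite entryE; set S := \sum_(_ < _ | _) _; rewrite -opprD; split.
    rewrite addrCA addrC => /eqP; rewrite addrC addr_eq0 => /eqP <-.
    by rewrite mulKf.
  by move->; rewrite mulVKf // addrCA addNr.
split=> [/is_trig_mxP trig t s lts | rec].
  by apply/zeroE => //; apply: trig.
(* A row i above the diagonal satisfies i < s < k, so it is among the first k rows. *)
apply/is_trig_mxP => i s lis; have ltk := ltn_trans lis (ltn_ord s).
have -> : i = widen_ord hkm (Ordinal ltk) by apply: val_inj.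
by apply/zeroE => //; apply: rec.
Qed.

Lemma upper_recursionP (R : realType) m n k (hk : (k <= minn m n)%N)
    (L C : 'M[R]_(m, k)) (P : 'M[R]_k) :
  lower_trapezoidal L ->
  (forall t : 'I_k, (t.+1 < k)%N -> L (row_idx hk t) t != 0) ->
  lower_trapezoidal (C + L *m P) <-> upper_recursion hk L C P.
Proof. exact: lower_trapezoidal_addmul. Qed.

Lemma lower_recursionP (R : realType) m n k (hk : (k <= minn m n)%N)
    (U B : 'M[R]_(k, n)) (P : 'M[R]_k) :
  upper_trapezoidal U ->
  (forall t : 'I_k, (t.+1 < k)%N -> U t (col_idx hk t) != 0) ->
  upper_trapezoidal (B - P *m U) <-> lower_recursion hk U B P.
Proof.
move=> trapU piv.
(* With [- B^T] in place of [C], the matrix C + L P becomes the negated transpose of [B - P *m U];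
   the sign does not affect which entries vanish. *)
have := @lower_trapezoidal_addmul R n k (leq_trans hk (geq_minr m n))
  U^T (- B^T) (P^T) trapU.
have -> : - B^T + U^T *m P^T = - (B - P *m U)^T.
  by rewrite -trmx_mul [(B - _)^T]linearB opprB addrC.
have -> : lower_trapezoidal (- (B - P *m U)^T) = upper_trapezoidal (B - P *m U).
  apply/is_trig_mxP/is_trig_mxP => trig i j /trig; rewrite !mxE => /eqP.
    by rewrite oppr_eq0 => /eqP.
  by move/eqP->; rewrite oppr0.
case=> [t /piv|to_rec of_rec]; first by rewrite mxE.
have recE (t s : 'I_k) : (U t (col_idx hk t))^-1 * (B s (col_idx hk t)
      - \sum_(r < k | (r < t)%N) P s r * U r (col_idx hk t)) =
    (U^T (col_idx hk t) t)^-1 * (- (- B^T) (col_idx hk t) s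
      - \sum_(r < k | (r < t)%N) U^T (col_idx hk t) r * P^T r s).
  rewrite !mxE opprK; congr (_ * (_ - _)).
  by apply: eq_bigr => r _; rewrite !mxE mulrC.
split=> [trap t s lts | rec].
  by rewrite recE -(to_rec trap) // mxE.
by apply: of_rec => t s lts; rewrite mxE rec // recE.
Qed.

(** The recursion is the linear system (1 + N) X = a, where N is the strictly lower part of [c]; 1 +
    N is unitriangular, hence invertible. *)
Lemma forward_substitution (R : realType) k p (c : 'M[R]_k) (a : 'M[R]_(k, p)) :
  exists X : 'M[R]_(k, p), forall t s,
    X t s = a t s - \sum_(r < k | (r < t)%N) c t r * X r s.
Proof.
pose N : 'M[R]_k := \matrix_(t, r) if (r < t)%N then c t r else 0.
have unitM : 1%:M + N \in unitmx.
  rewrite unitmxE det_trig.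
    rewrite big1 ?unitr1 // => i _.
    by rewrite !mxE eqxx ltnn addr0.
  apply/is_trig_mxP => i j lij; rewrite !mxE ltnNge ltnW //= addr0.
  by rewrite -val_eqE /= ltn_eqF.
exists (invmx (1%:M + N) *m a) => t s.
have /matrixP/(_ t s) := mulKVmx unitM a.
set X := invmx _ *m a; rewrite mulmxDl mul1mx mxE => <-.
suff -> : (N *m X) t s = \sum_(r < k | (r < t)%N) c t r * X r s.
  by rewrite addrK.
rewrite mxE [RHS]big_mkcond; apply: eq_bigr => r _.
by rewrite mxE; case: ifP; rewrite ?mul0r.
Qed.

Lemma recursions_solvable (R : realType) m n k (hk : (k <= minn m n)%N)
    (L C : 'M[R]_(m, k)) (U B : 'M[R]_(k, n)) :
  exists P : 'M[R]_k, lower_recursion hk U B P /\ upper_recursion hk L C P.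
Proof.
(* [X] holds the transposed unknown, X t s standing for P s t, so that this recursion also descends
   by rows. A zero pivot has inverse 0 here, so the coefficients are always defined. *)
have [X XE] := forward_substitution _ _ _
  (\matrix_(t, r) ((U t (col_idx hk t))^-1 * U r (col_idx hk t)))
  (\matrix_(t, s < k) ((U t (col_idx hk t))^-1 * B s (col_idx hk t))).
have [Y YE] := forward_substitution _ _ _
  (\matrix_(t, r) ((L (row_idx hk t) t)^-1 * L (row_idx hk t) r))
  (\matrix_(t, s < k) ((L (row_idx hk t) t)^-1 * - C (row_idx hk t) s)).
(* The diagonal occurs in neither recursion; taking it from [X] is an arbitrary choice. *)
exists (\matrix_(i, j) if (i < j)%N then Y i j else X j i).
split=> t s lts; rewrite !mxE.
  rewrite ltnNge ltnW //= XE mxE mulrBr mulr_sumr; congr (_ - _).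
  apply: eq_bigr => r lrt.
  by rewrite !mxE ltnNge ltnW ?(ltn_trans lrt) //= -mulrA [U _ _ * X _ _]mulrC.
rewrite lts YE mxE mulrBr mulr_sumr; congr (_ - _).
by apply: eq_bigr => r lrt; rewrite !mxE (ltn_trans lrt) // mulrA.
Qed.

Theorem theorem4p1 (R : realType) (m n k : nat) (hmn : (n <= m)%N)
    (hk : (k <= minn m n)%N) (As Ai : 'M[R]_(m, n))
    (Ls : 'M[R]_(m, k)) (Us : 'M[R]_(k, n))
    (hLU : is_LU As Ls Us) (hpiv : nonzero_pivots hk Ls Us) :
  let A := DualMx As Ai in
  let B := mpinv Ls *m Ai in
  let C := (1%:M - Ls *m mpinv Ls) *m Ai *m mpinv Us in
  let cond :=
    (1%:M - Ls *m mpinv Ls) *m Ai *m (1%:M - mpinv Us *m Us) = 0 in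
  ((exists (L : dualmx R m k) (U : dualmx R k n),
      [/\ std_part L = Ls, std_part U = Us & is_dual_LU A L U]) <-> cond)
  /\
  (cond -> forall (Li : 'M[R]_(m, k)) (Ui : 'M[R]_(k, n)),
     is_dual_LU A (DualMx Ls Li) (DualMx Us Ui) <->
     exists P : 'M[R]_k,
       [/\ Li = (1%:M - Ls *m mpinv Ls) *m Ai *m mpinv Us + Ls *m P,
           Ui = mpinv Ls *m Ai - P *m Us,
           lower_recursion hk Us B P &
           upper_recursion hk Ls C P]).
Proof.
move=> A B C cond; case: hLU => DAs [trapL rL] [trapU rU].
have upP P : lower_trapezoidal (C + Ls *m P) <-> upper_recursion hk Ls C P.
  by apply: upper_recursionP => // t /hpiv[].
have lowP P : upper_trapezoidal (B - P *m Us) <-> lower_recursion hk Us B P.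
  by apply: lower_recursionP => // t /hpiv[].
(* The infinitesimal part of the product supplies [P], and the trapezoidal shapes of [Li] and [Ui]
   become the two recursions. *)
have LUP Li Ui : cond -> is_dual_LU A (DualMx Ls Li) (DualMx Us Ui) <->
    exists P : 'M[R]_k, [/\ Li = C + Ls *m P, Ui = B - P *m Us,
      lower_recursion hk Us B P & upper_recursion hk Ls C P].
  move=> hcond; split.
    case=> -[_ DAi] /andP[_ trapLi] /andP[_ trapUi].
    have [P [DLi DUi]] := (dual_factorP R m n k Ai Ls Li Us Ui rL rU hcond).1 DAi.
    exists P; split=> //; first by apply/lowP; rewrite -DUi.
    by apply/upP; rewrite -DLi.
  case=> P [DLi DUi /lowP trapUi /upP trapLi]; split.
  - rewrite /A DAs; congr DualMx.
    by apply/(dual_factorP R m n k Ai Ls Li Us Ui rL rU hcond); exists P.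
  - by rewrite /dual_lower_trapezoidal /= trapL DLi.
  - by rewrite /dual_upper_trapezoidal /= trapU DUi.
split=> [|hcond Li Ui]; last exact: LUP.
split=> [[L [U [DL DU [[_ DAi] _ _]]]] | hcond].
  by rewrite DL DU in DAi; apply: dual_factor_cond DAi.
(* Sufficiency: any solution of both recursions yields a factorization through the
   parametrization. *)
have [P [low up]] := recursions_solvable _ _ _ _ hk Ls C Us B.
exists (DualMx Ls (C + Ls *m P)), (DualMx Us (B - P *m Us)); split=> //.
by apply/LUP => //; exists P.
Qed.
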